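(* Let $\frac{r}{s}$ be a rational number greater than $1$ and let $\frac{\mathcal{R}}{\mathcal{S}}=\left[\frac{r}{s}\right]_q$ be its $q$-deformation. Then $$\mathcal{R}=\sum_{\pi:\frac{r}{s}\to\frac10}q^{\mathrm{coar}(\pi)},\qquad \mathcal{S}=\sum_{\pi:\frac{r}{s}\to\frac11}q^{\mathrm{coar}(\pi)},$$ where the sums run over all oriented paths $\pi$ in the oriented Farey tessellation from $\frac rs$ to $\frac10$, respectively from $\frac rs$ to $\frac11$, and $\mathrm{coar}(\pi)$ is the coarea of $\pi$.
   Context: Rationals are written in irreducible form $\frac rs$ with nonnegative coprime $r,s$, and one adds the point $\frac10$ (infinity). Farey tessellation: its vertices are the elements of $\mathbb{Q}_{>0}\cup\{\frac01,\frac10\}$, ordered on a horizontal segment from $\frac01$ (left end) to $\frac10$ (right end); two vertices $\frac rs,\frac{r'}{s'}$ are joined by an edge (a half-circle above the segment) whenever $rs'-r's=\pm1$. The triangles are exactly those with vertices $\frac rs<\frac{r+r'}{s+s'}<\frac{r'}{s'}$ where $\frac rs,\frac{r'}{s'}$ are joined by an edge; $\frac{r+r'}{s+s'}$ is the median vertex of the triangle. Every vertex other than $\frac01,\frac10$ is the median vertex of a unique triangle. $q$-rationals: every edge except $\{\frac01,\frac10\}$ receives a weight (a power of $q$) and every vertex $\frac rs$ receives a pair $(\mathcal R,\mathcal S)$ of polynomials in $q$, recursively. Start: $\frac01$ has pair $(0,1)$, $\frac10$ has pair $(1,0)$, $\frac11$ has pair $(1,1)$, and the edges $\{\frac01,\frac11\}$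 and $\{\frac11,\frac10\}$ have weight $1$. Local rule: if $\frac rs<\frac{r'}{s'}$ are joined by an edge of weight $q^{d-1}$ and have pairs $(\mathcal R,\mathcal S)$ and $(\mathcal R',\mathcal S')$, then the median vertex $\frac{r+r'}{s+s'}$ has pair $(\mathcal R+q^d\mathcal R',\ \mathcal S+q^d\mathcal S')$, the edge from it to $\frac rs$ has weight $1$, and the edge from it to $\frac{r'}{s'}$ has weight $q^d$. The $q$-deformation of $\frac rs$ is $\left[\frac rs\right]_q=\frac{\mathcal R}{\mathcal S}$, with numerator $\mathcal R$ and denominator $\mathcal S$ given by this recursion. Orientation: every edge other than $\{\frac01,\frac10\}$ is oriented so that in each triangle the two edges at the median vertex go out of the median vertex; so each vertex other than $\frac01,\frac10$ has exactly two outgoing edges, one to the left and one to the right. A path $\pi:\frac{r_0}{s_0}\to\frac{r_n}{s_n}$ is a sequence $\frac{r_0}{s_0}\to\frac{r_1}{s_1}\to\cdots\to\frac{r_n}{s_n}$ of consecutive oriented edges. Left-path: the left-path of $\frac rs>1$ is the path from $\frac rs$ to $\frac10$ which follows the left-going edges from $\frac rs$ until it reaches $\frac11$ and then uses the edge from $\frac11$ to $\frac10$. Coarea: for a path $\pi$ starting at $\frac rs$ and ending at $\frac10$ or $\frac11$, $\mathrm{coar}(\pi)$ is the number of triangles of the tessellation enclosed between $\pi$ and the left-path of $\frac rs$ (i.e. contained in the bounded region(s) delimited by the two paths). When $\pi$ ends at $\frac11$, only the portion of the left-path from $\frac rs$ to $\frac11$ is involved; equivalently, $\pi$ is first extended by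 the edge $\frac11\to\frac10$, which does not change the count. *)

(* Defs.v *)
From mathcomp Require Import all_boot all_order all_algebra.
From mathcomp Require Import finmap.
From mathcomp Require Import all_classical all_reals all_analysis.
From mathcomp Require Import zify.

Set Implicit Arguments.
Unset Strict Implicit.
Unset Printing Implicit Defensive.

Import Order.TTheory GRing.Theory Num.Theory.
Import numFieldNormedType.Exports.

Local Open Scope classical_set_scope.
Local Open Scope ring_scope.

(* [(r, s)] stands for the irreducible fraction r/s, so [(1, 0)] is the point
   at infinity.  The type also contains pairs that are not vertices of the
   Farey tessellation; no such pair is an endpoint of an [edge]. *)
Definition vertex : Type := (nat * nat)%type.

Definition vlt (u w : vertex) : bool := (u.1 * w.2 < w.1 * u.2)%N.

Definition edge (u w : vertex) : bool :=
  (u.1 * w.2)%:Z - (w.1 * u.2)%:Z \in [:: 1; -1].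

Definition mediant (u w : vertex) : vertex := (u.1 + w.1, u.2 + w.2)%N.

(* Vertices listed from left to right: the middle one is the median vertex. *)
Definition triangle (t : vertex * vertex * vertex) : bool :=
  let: (u, m, w) := t in [&& vlt u w, edge u w & m == mediant u w].

(* [edge_weight u w e]: the edge joining u < w has weight q ^ e.  In the usual
   notation q ^ (d - 1) for the weight of the parent edge, e = d - 1. *)
Inductive edge_weight : vertex -> vertex -> nat -> Prop :=
| edge_weight_01 : edge_weight (0, 1)%N (1, 1)%N 0
| edge_weight_10 : edge_weight (1, 1)%N (1, 0)%N 0
| edge_weight_left u w e :
    edge_weight u w e -> edge_weight u (mediant u w) 0
| edge_weight_right u w e :
    edge_weight u w e -> edge_weight (mediant u w) w e.+1.

(* [qdeformation v (N, D)]: N and D are the numerator and the denominator of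
   the q-deformation of v; the indeterminate 'X plays the role of q. *)
Inductive qdeformation : vertex -> {poly int} * {poly int} -> Prop :=
| qdeformation_0 : qdeformation (0, 1)%N (0, 1)
| qdeformation_oo : qdeformation (1, 0)%N (1, 0)
| qdeformation_1 : qdeformation (1, 1)%N (1, 1)
| qdeformation_mediant u w e N D N' D' :
    edge_weight u w e -> qdeformation u (N, D) -> qdeformation w (N', D') ->
    qdeformation (mediant u w) (N + 'X^(e.+1) * N', D + 'X^(e.+1) * D').

(* [qdeformation] is therefore satisfiable at every vertex. *)
Lemma qdeformation_exists (r s : nat) :
  coprime r s -> exists ND, qdeformation (r, s) ND.
Proof.
have key n u w e i j v : (i + j <= n)%N -> (0 < i)%N -> (0 < j)%N ->
    coprime i j -> edge_weight u w e ->
    (exists ND, qdeformation u ND) -> (exists ND, qdeformation w ND) ->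
    v = (i * u.1 + j * w.1, i * u.2 + j * w.2)%N ->
    exists ND, qdeformation v ND.
  elim: n u w e i j v => [|n IHn] u w e i j v; first by case: i.
  move=> le_ij i0 j0 co_ij euw qu qw ->.
  have qm : exists ND, qdeformation (mediant u w) ND.
    case: qu qw => [[N D] qu] [[N' D'] qw].
    by eexists; apply: qdeformation_mediant euw qu qw.
  have [lt_ij|lt_ji|eq_ij] := ltngtP i j.
  - apply: (IHn _ _ _ i (j - i)%N _ _ _ _ _ (edge_weight_right euw) qm qw);
      [lia|exact: i0|by rewrite subn_gt0| |].
      by rewrite /coprime -(gcdnDr i (j - i)) subnK // ltnW.
    by rewrite /= !mulnDr !mulnBl; congr pair; nia.
  - apply: (IHn _ _ _ (i - j)%N j _ _ _ _ _ (edge_weight_left euw) qu qm);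
      [lia|by rewrite subn_gt0|exact: j0| |].
      by rewrite coprime_sym /coprime -(gcdnDr j (i - j)) subnK 1?ltnW //
        -/(coprime j i) coprime_sym.
    by rewrite /= !mulnDr !mulnBl; congr pair; nia.
  - move: qm; rewrite /mediant; move: co_ij.
    by rewrite -eq_ij /coprime gcdnn => /eqP ->; rewrite !mul1n.
move=> co_rs.
have q0 : exists ND, qdeformation (0, 1)%N ND by eexists; constructor.
have q1 : exists ND, qdeformation (1, 1)%N ND by eexists; constructor.
have qoo : exists ND, qdeformation (1, 0)%N ND by eexists; constructor.
have [r0|r_gt0] := posnP r.
  by move: co_rs; rewrite r0 /coprime gcd0n => /eqP ->.
have [s0|s_gt0] := posnP s.
  by move: co_rs; rewrite s0 /coprime gcdn0 => /eqP ->.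
have [lt_rs|lt_sr|eq_rs] := ltngtP r s.
- apply: (key _ _ _ _ (s - r)%N r _ (leqnn _) _ _ _ edge_weight_01 q0 q1) => //.
  + by rewrite subn_gt0.
  + by rewrite coprime_sym /coprime -(gcdnDr r (s - r)) subnK // ltnW.
  + by congr pair => /=; lia.
- apply: (key _ _ _ _ s (r - s)%N _ (leqnn _) _ _ _
    edge_weight_10 q1 qoo) => //.
  + by rewrite subn_gt0.
  + rewrite /coprime -(gcdnDr s (r - s)) subnK 1?ltnW //.
    by rewrite -/(coprime s r) coprime_sym.
  + by congr pair => /=; lia.
- by move: co_rs q1; rewrite eq_rs /coprime gcdnn => /eqP ->.
Qed.

Definition oriented_edge (m u : vertex) : Prop :=
  exists a b, triangle (a, m, b) /\ (u = a \/ u = b).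

Definition left_edge (m u : vertex) : Prop := oriented_edge m u /\ vlt u m.

(* A path from v to w is given by the sequence of its vertices other than v. *)
Definition paths (v w : vertex) : set (seq vertex) :=
  [set p | path (fun x y => `[< oriented_edge x y >]) v p /\ last v p = w].

Definition left_going_paths (v w : vertex) : set (seq vertex) :=
  [set p | path (fun x y => `[< left_edge x y >]) v p /\ last v p = w].

(* The portion of the left-path of v from v to 1/1; this sequence is unique,
   and it exists when v is a rational number at least 1. *)
Definition left_path_to_1 (v : vertex) : seq vertex :=
  xget [::] (left_going_paths v (1, 1)%N).

Definition left_path (v : vertex) : seq vertex :=
  rcons (left_path_to_1 v) (1, 0)%N.

Section Drawing.
Variable R : realType.

(* r/s is placed at abscissa r / (r + s): this is increasing in r/s and sends
   0/1 and 1/0 to the ends of the segment [0, 1] of the horizontal axis. *)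
Definition abscissa (v : vertex) : R := v.1%:R / (v.1 + v.2)%:R.

(* Closed half-circle, and open half-disc, of diameter [u, w]. *)
Definition half_circle (u w : vertex) : set (R * R) :=
  [set z | 0 <= z.2 /\
    (z.1 - (abscissa u + abscissa w) / 2) ^+ 2 + z.2 ^+ 2 =
    ((abscissa w - abscissa u) / 2) ^+ 2].

Definition half_disc (u w : vertex) : set (R * R) :=
  [set z | 0 < z.2 /\
    (z.1 - (abscissa u + abscissa w) / 2) ^+ 2 + z.2 ^+ 2 <
    ((abscissa w - abscissa u) / 2) ^+ 2].

(* Interior of a triangle: its sides and its vertices are left out, as they
   may lie on the paths. *)
Definition triangle_interior (t : vertex * vertex * vertex) : set (R * R) :=
  let: (u, m, w) := t in
  half_disc u w `\` (half_disc u m `|` half_circle u m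
                     `|` half_disc m w `|` half_circle m w).

Definition path_curve (v : vertex) (p : seq vertex) : set (R * R) :=
  \bigcup_(e in [set` zip (v :: p) p]) half_circle e.1 e.2.

(* Union of the bounded regions of the plane delimited by K. *)
Definition enclosed (K : set (R * R)) : set (R * R) :=
  [set z | ~ K z /\ bounded_set (connected_component (~` K) z)].

(* A path ending at 1/1 is compared with the portion of the left-path that
   ends at 1/1. *)
Definition coarea (v : vertex) (p : seq vertex) : nat :=
  let l := if last v p == (1, 1)%N then left_path_to_1 v else left_path v in
  #|` fset_set [set t | triangle t /\
        triangle_interior t `<=` enclosed (path_curve v p `|` path_curve v l)]|.

End Drawing.

(* Main.v *)
Require Import Defs.
From mathcomp Require Import all_boot all_order all_algebra.
From mathcomp Require Import finmap.
From mathcomp Require Import all_classical all_reals all_analysis.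
From mathcomp Require Import zify ring lra.

Set Implicit Arguments.
Unset Strict Implicit.
Unset Printing Implicit Defensive.

Import Order.TTheory GRing.Theory Num.Theory.
Import numFieldNormedType.Exports.

Local Open Scope classical_set_scope.
Local Open Scope ring_scope.

(** Everything rests on locating one triangle T with vertices u < m < w with
    respect to the two paths that start at v.  Edges do not cross
    ([edge_inside]) and oriented edges only lead out of the domain under the arc
    from u to w ([oriented_edge_inside]), so a path that starts under this arc
    leaves it once and for all, through u or through w, and a path that starts
    elsewhere never enters it.  If u is at least 1, the left-path leaves through u.
    Hence T lies between a path and the left-path exactly when u is at least 1, v is
    under the arc and the path leaves through w; [right_exits] is the set of
    these triangles.

    This description gives the recursion.  If v is the mediant of a < b, then a
    first step to a changes nothing, whereas a first step to b adds the fan of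
    triangles at b over fractions at least 1 that this step cuts off
    ([right_exits_left], [right_exits_right]).  If the edge from a to b has
    weight q^(d-1), this fan has d triangles, as the weights grow by the same
    rule as the fans ([card_fan]).  Splitting paths according to their first
    step therefore reproduces the local rule that defines the q-deformation
    ([qdeformation_path_sum]).

    It remains to see that the bounded regions of the drawing are the ones just
    described ([coareaE]).  For T in [right_exits], count with signs the
    half-discs of the edges of a path that contain a given point.  The
    difference of the counts for two paths with the same ends is locally
    constant off the curves, also across the horizontal axis, because there the
    signs telescope ([winding_diff_near]); it vanishes far away, and it equals
    -1 on T, as the edges that follow the exit telescope as well
    ([winding_interior]).  So T is enclosed.  For any other triangle, some
    interior point can go straight down to infinity: a point close to w when the
    path misses the domain under the arc or leaves it through u, and a point
    close to 0/1 for the triangle from 0/1 to 1/0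
    ([not_right_exits_not_enclosed]). *)

(** * Arithmetic of Farey neighbours *)

(** The condition rs' - r's = -1 without subtraction: an edge of the
    tessellation whose ends are listed from left to right. *)
Definition consecutive (u w : vertex) : bool := (w.1 * u.2 == u.1 * w.2 + 1)%N.

Lemma consecutiveE u w : consecutive u w = vlt u w && edge u w.
Proof.
by rewrite /consecutive /vlt /edge !inE; lia.
Qed.

Lemma triangleE u m w :
  triangle (u, m, w) = consecutive u w && (m == mediant u w).
Proof. by rewrite /triangle consecutiveE andbA. Qed.

Lemma oriented_edgeP x y :
  oriented_edge x y <->
  exists a b, [/\ consecutive a b, x = mediant a b & y = a \/ y = b].
Proof.
split=> -[a [b]].
  by rewrite triangleE => -[/andP[ab /eqP xE] yE]; exists a, b.
by case=> ab xE yE; exists a, b; rewrite triangleE ab xE eqxx.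
Qed.

Definition inside (u w x : vertex) : bool := vlt u x && vlt x w.

(** Two neighbours form a basis of the lattice of integer pairs; the signs of
    the coordinates [k] and [l] locate [x] with respect to [u] and [w]. *)
Lemma consecutive_coord u w x : consecutive u w ->
  exists k l : int, [/\ (x.1%:Z = k * u.1%:Z + l * w.1%:Z)%R,
    (x.2%:Z = k * u.2%:Z + l * w.2%:Z)%R,
    vlt u x = (0 < l)%R & vlt x w = (0 < k)%R].
Proof.
case: u w x => [u1 u2] [w1 w2] [x1 x2]; rewrite /consecutive /vlt /= => /eqP uw.
have uwZ : (w1%:Z * u2%:Z = u1%:Z * w2%:Z + 1)%R by lia.
exists (w1%:Z * x2%:Z - x1%:Z * w2%:Z)%R, (x1%:Z * u2%:Z - u1%:Z * x2%:Z)%R.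
split; [| |lia|lia].
- by transitivity (x1%:Z * (w1%:Z * u2%:Z - u1%:Z * w2%:Z))%R; [rewrite uwZ|];
    ring.
- by transitivity (x2%:Z * (w1%:Z * u2%:Z - u1%:Z * w2%:Z))%R; [rewrite uwZ|];
    ring.
Qed.

(** The mediant is the simplest fraction between two neighbours: both
    coordinates of [x] in the basis are at least 1. *)
Lemma inside_ge u w x : consecutive u w -> inside u w x ->
  (u.1 + w.1 <= x.1)%N /\ (u.2 + w.2 <= x.2)%N.
Proof.
move=> uw; case: (consecutive_coord x uw) => k [l] [x1 x2].
rewrite /inside => -> -> /andP[l0 k0].
by split; nia.
Qed.

(** Edges do not cross: an edge with one end strictly under the arc from [u]
    to [w] has its other end under this arc or at one of its ends.  Otherwise
    the coordinates of the two ends in the basis would have a determinant of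
    absolute value at least 2. *)
Lemma edge_inside u w x y : consecutive u w -> inside u w x ->
  consecutive x y || consecutive y x -> [|| inside u w y, y == u | y == w].
Proof.
move=> uw; have := uw; rewrite /consecutive => /eqP uw1.
case: (consecutive_coord x uw) => i [j] [x1 x2].
case: (consecutive_coord y uw) => k [l] [y1 y2].
rewrite /inside => -> -> -> -> /andP[j0 i0] xy.
have {}xy : (i * l - j * k = 1 \/ i * l - j * k = -1)%R.
  have dE : (x.2%:Z * y.1%:Z - x.1%:Z * y.2%:Z =
      (i * l - j * k) * (w.1%:Z * u.2%:Z - u.1%:Z * w.2%:Z))%R.
    by rewrite x1 x2 y1 y2; ring.
  have d1 : (w.1%:Z * u.2%:Z - u.1%:Z * w.2%:Z = 1)%R by lia.
  rewrite d1 mulr1 in dE; rewrite -dE.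
  by case/orP: xy; rewrite /consecutive => /eqP xy; [left|right]; lia.
have yP : (0 < y.1)%N || (0 < y.2)%N.
  apply: contraT; rewrite negb_or -!leqNgt !leqn0 => /andP[/eqP y10 /eqP y20].
  exfalso; have kE : k = (y.2%:Z * w.1%:Z - y.1%:Z * w.2%:Z)%R.
    by rewrite y1 y2; transitivity (k * (w.1%:Z * u.2%:Z - u.1%:Z * w.2%:Z))%R;
    [have -> : (w.1%:Z * u.2%:Z - u.1%:Z * w.2%:Z = 1)%R by lia|]; ring.
  have lE : l = (y.1%:Z * u.2%:Z - y.2%:Z * u.1%:Z)%R.
    by rewrite y1 y2; transitivity (l * (w.1%:Z * u.2%:Z - u.1%:Z * w.2%:Z))%R;
    [have -> : (w.1%:Z * u.2%:Z - u.1%:Z * w.2%:Z = 1)%R by lia|]; ring.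
  by rewrite y10 y20 !mul0r subr0 in kE lE; rewrite kE lE !mulr0 in xy; lia.
have kl : (0 < l /\ 0 < k \/ l = 0 /\ k = 1 \/ l = 1 /\ k = 0)%R.
  have [l0|l0|l0] := ltgtP l 0; have [k0|k0|k0] := ltgtP k 0.
  - by exfalso; move: yP; nia.
  - by exfalso; case: xy; nia.
  - by exfalso; case: xy; nia.
  - by exfalso; case: xy; nia.
  - by left.
  - right; right; split=> //; subst k; rewrite mulr0 subr0 in xy.
    by case: xy; nia.
  - by exfalso; move: yP; nia.
  - right; left; split=> //; subst l; rewrite mulr0 sub0r in xy.
    by case: xy; nia.
  - by exfalso; subst l k; rewrite !mulr0 in xy; lia.
case: kl => [[-> ->]|[[l0 k1]|[l1 k0]]] //; subst l k.
- have -> : y == u by rewrite (surjective_pairing y) (surjective_pairing u);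
    apply/eqP; congr pair; lia.
  by rewrite !orbT.
- have -> : y == w by rewrite (surjective_pairing y) (surjective_pairing w);
    apply/eqP; congr pair; lia.
  by rewrite !orbT.
Qed.

Lemma oriented_edge_consecutive x y : oriented_edge x y ->
  consecutive x y || consecutive y x.
Proof.
move=> /oriented_edgeP[a [b [ab -> [->|->]]]]; move: ab;
  rewrite /consecutive /mediant /=; nia.
Qed.

(** Oriented edges only leave the domain under an arc: the parents of a vertex
    are smaller than it in both coordinates, whereas all vertices under the
    arc are larger than its ends. *)
Lemma oriented_edge_inside u w x y : consecutive u w -> oriented_edge x y ->
  inside u w y -> inside u w x.
Proof.
move=> uw xy yin; have := edge_inside uw yin.
move=> /(_ x); rewrite orbC => /(_ (oriented_edge_consecutive xy)).
case/or3P => // /eqP xE; exfalso; have := inside_ge uw yin.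
  case/oriented_edgeP: xy => a [b [ab xab yab]].
  move: uw ab; rewrite /consecutive -xE xab /mediant /= => uw ab.
  by case: yab => ->; nia.
case/oriented_edgeP: xy => a [b [ab xab yab]].
move: uw ab; rewrite /consecutive -xE xab /mediant /= => uw ab.
by case: yab => ->; nia.
Qed.

Lemma oriented_edge_exit u w x y : consecutive u w -> oriented_edge x y ->
  inside u w x -> ~~ inside u w y -> y = u \/ y = w.
Proof.
move=> uw /oriented_edge_consecutive xy xin yin.
by case/or3P: (edge_inside uw xin xy) yin => [->//|/eqP|/eqP]; tauto.
Qed.

(** A parent [a] of the mediant of [a'] and [b'] cannot leave their interval, as
    edges do not cross, and it is too small to lie strictly inside. *)
Lemma parents_unique a b a' b' : consecutive a b -> consecutive a' b' ->
  mediant a b = mediant a' b' -> a = a' /\ b = b'.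
Proof.
case: a b a' b' => [a1 a2] [b1 b2] [c1 c2] [d1 d2].
rewrite /consecutive /mediant /= => /eqP ab /eqP cd [e1 e2].
have ain : inside (c1, c2) (d1, d2) (a1, a2) = false.
  apply/negP => /inside_ge; rewrite /consecutive /= cd eqxx => /(_ isT) [? ?].
  by nia.
have bin : inside (c1, c2) (d1, d2) (b1, b2) = false.
  apply/negP => /inside_ge; rewrite /consecutive /= cd eqxx => /(_ isT) [? ?].
  by nia.
have med : inside (c1, c2) (d1, d2) (a1 + b1, a2 + b2)%N.
  by rewrite e1 e2 /inside /vlt /=; apply/andP; split; nia.
have cdadj : consecutive (c1, c2) (d1, d2) by rewrite /consecutive /= cd.
have := edge_inside (y := (a1, a2)) cdadj med.
rewrite ain /consecutive /= => /(_ _)/orP-[|/eqP[? ?]|/eqP[? ?]].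
- by apply/orP; right; apply/eqP; rewrite mulnDl mulnDr ab addnA.
- subst c1 c2; move/eqP: e1; move/eqP: e2; rewrite !eqn_add2l.
  by move=> /eqP -> /eqP ->.
- exfalso; subst d1 d2; rewrite addnC in e1; rewrite addnC in e2.
  move/eqP: e1; move/eqP: e2; rewrite !eqn_add2r => /eqP e2 /eqP e1.
  by move: ab cd; rewrite e1 e2; clear; lia.
Qed.

Definition ge_one (v : vertex) : bool := (v.2 <= v.1)%N.

Lemma mediant_inside a b : consecutive a b -> inside a b (mediant a b).
Proof. by rewrite /consecutive /inside /vlt /mediant /=; lia. Qed.

Lemma vlt_irr v : vlt v v = false.
Proof. by rewrite /vlt ltnn. Qed.

Lemma consecutive_vlt a b : consecutive a b -> vlt a b.
Proof. by rewrite /consecutive /vlt; lia. Qed.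

Lemma consecutive_mediantl a b : consecutive a b -> consecutive a (mediant a b).
Proof. by rewrite /consecutive /mediant /=; lia. Qed.

Lemma consecutive_mediantr a b : consecutive a b -> consecutive (mediant a b) b.
Proof. by rewrite /consecutive /mediant /=; lia. Qed.

Lemma mediant_edgel a b : consecutive a b -> oriented_edge (mediant a b) a.
Proof. by move=> ab; apply/oriented_edgeP; exists a, b; split=> //; left. Qed.

Lemma mediant_edger a b : consecutive a b -> oriented_edge (mediant a b) b.
Proof. by move=> ab; apply/oriented_edgeP; exists a, b; split=> //; right. Qed.

Lemma edge_weight_consecutive u w e : edge_weight u w e -> consecutive u w.
Proof.
elim=> // {}u {}w {}e _.
  exact: consecutive_mediantl.
exact: consecutive_mediantr.
Qed.

(** Only the edge from 0/1 to 1/0 passes over 1/1, and it has no weight. *)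
Lemma edge_weight_one u w e : edge_weight u w e ->
  ge_one u \/ (w.1 <= w.2)%N.
Proof.
elim=> [||{}u {}w {}e uw IH|{}u {}w {}e uw IH]; rewrite /ge_one /=;
  [by right|by left| |];
  have := edge_weight_consecutive uw; move: IH; rewrite /consecutive /ge_one.
- move=> [?|?] uw1; [by left|right]; nia.
- move=> [?|?] uw1; [left|by right]; nia.
Qed.

Lemma ge_one_left u w e : edge_weight u w e -> ge_one (mediant u w) -> ge_one u.
Proof.
move=> uw; have := edge_weight_consecutive uw; case: (edge_weight_one uw) => //.
by rewrite /ge_one /consecutive /mediant /=; nia.
Qed.

(** * The triangles between a path and the left-path *)

(** The first vertex of the path that is not strictly between [u] and [w]; it
    is one of these two when the path starts between them and leaves.  A path
    that stays between them yields its last vertex. *)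
Fixpoint exit_vertex (u w v : vertex) (p : seq vertex) : vertex :=
  if p is y :: p' then
    if inside u w v then exit_vertex u w y p' else v
  else v.

Lemma exit_outside u w v p : ~~ inside u w v -> exit_vertex u w v p = v.
Proof. by case: p => //= y p /negbTE ->. Qed.

(** If [v] is under the arc from [u] to [w] and [u] is at least 1, the left-path
    of [v] leaves this domain through [u]; the triangle just under the arc is therefore between
    the two paths exactly when the other path leaves through [w]. *)
Definition right_exits (v : vertex) (p : seq vertex) :
    set (vertex * vertex * vertex) :=
  [set t | triangle t /\ let: (u, m, w) := t in
    [/\ ge_one u, inside u w v & exit_vertex u w v p = w]].

(** The triangles around [b] on the left of its edge to [v], when there is such
    an edge. *)
Definition fan (v b : vertex) : set (vertex * vertex * vertex) :=
  [set t | triangle t /\ let: (u, m, w) := t in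
    [/\ w = b, ge_one u & vlt u v]].

Lemma right_exits_nil v : right_exits v [::] = set0.
Proof.
rewrite -subset0 => -[[u m] w] [_ [_ + /= vw]].
by rewrite vw /inside vlt_irr andbF.
Qed.

(** A first step to the left is also the first step of the left-path. *)
Lemma right_exits_left a b p : consecutive a b ->
  right_exits (mediant a b) (a :: p) = right_exits a p.
Proof.
move=> ab; apply/seteqP; split=> -[[u m] w] [T [u1 vin ex]]; split=> //.
  move: ex => /=; rewrite vin => ex.
  case ain: (inside u w a); first by split.
  move: vin; rewrite -ex exit_outside ?ain// => /andP[_].
  by have /andP[+ _] := mediant_inside ab; rewrite /vlt; lia.
have uw : consecutive u w by move: T; rewrite triangleE => /andP[].
have min := oriented_edge_inside uw (mediant_edgel ab) vin.
by split=> //=; rewrite min.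
Qed.

(** A step to the right adds the fan of triangles at the new vertex that it
    cuts off. *)
Lemma right_exits_right a b p : consecutive a b ->
  right_exits (mediant a b) (b :: p) = fan (mediant a b) b `|` right_exits b p.
Proof.
move=> ab; apply/seteqP; split=> -[[u m] w].
- move=> [T [u1 vin /=]]; rewrite vin => ex.
  case bin: (inside u w b); first by right.
  left; split=> //; rewrite exit_outside ?bin// in ex.
  by split=> //; case/andP: vin.
- move=> [[T [wb u1 uv]]|[T [u1 vin ex]]].
    subst w.
    have /andP[_ mb] := mediant_inside ab.
    have min : inside u b (mediant a b) by rewrite /inside uv mb.
    by split=> //; split=> //=; rewrite min exit_outside// /inside vlt_irr andbF.
  have uw : consecutive u w by move: T; rewrite triangleE => /andP[].
  have min := oriented_edge_inside uw (mediant_edger ab) vin.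
  by split=> //; split=> //=; rewrite min.
Qed.

Lemma fan_right_exits_disjoint v b p : fan v b `&` right_exits b p = set0.
Proof.
rewrite -subset0 => -[[u m] w] [[_ [-> _ _]] [_ [_ + _]]].
by rewrite /inside vlt_irr andbF.
Qed.

Lemma fan_mediantl u w : consecutive u w -> fan u (mediant u w) = set0.
Proof.
move=> uw; rewrite -subset0 => -[[x m] y] [T [yE _ xu]]; move: T.
rewrite triangleE yE => /andP[xm _]; have := inside_ge xm (x := u).
rewrite /inside xu consecutive_vlt ?consecutive_mediantl// => /(_ isT).
by move: uw; rewrite /consecutive /=; nia.
Qed.

(** Comparing the two determinant conditions shows that left neighbours of [w]
    differ by a multiple [l] of [w], whose value orders them. *)
Lemma consecutive_progression u x w : consecutive u w -> consecutive x w ->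
  exists l : int, [/\ (x.1%:Z = u.1%:Z + l * w.1%:Z)%R,
    (x.2%:Z = u.2%:Z + l * w.2%:Z)%R, vlt x u = (l < 0)%R
    & vlt x (mediant u w) = (l < 1)%R].
Proof.
case: u x w => [u1 u2] [x1 x2] [w1 w2].
rewrite /consecutive /vlt /mediant /= => /eqP uw /eqP xw.
pose l := (x1%:Z * u2%:Z - u1%:Z * x2%:Z)%R.
have uwZ : (w1%:Z * u2%:Z = u1%:Z * w2%:Z + 1)%R by lia.
have xwZ : (w1%:Z * x2%:Z = x1%:Z * w2%:Z + 1)%R by lia.
have lE : (l = x1%:Z * u2%:Z - u1%:Z * x2%:Z)%R by [].
exists l; split; last 2 first.
- by lia.
- by lia.
- rewrite /l; have -> : ((x1%:Z * u2%:Z - u1%:Z * x2%:Z) * w1%:Z =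
    x1%:Z * (w1%:Z * u2%:Z) - u1%:Z * (w1%:Z * x2%:Z))%R by ring.
  by rewrite uwZ xwZ; ring.
- rewrite /l; have -> : ((x1%:Z * u2%:Z - u1%:Z * x2%:Z) * w2%:Z =
    u2%:Z * (x1%:Z * w2%:Z + 1) - x2%:Z * (u1%:Z * w2%:Z + 1) - u2%:Z + x2%:Z)%R
    by ring.
  by rewrite -uwZ -xwZ; ring.
Qed.

Lemma fan_mediantr u w : consecutive u w -> ge_one u ->
  fan (mediant u w) w = (u, mediant u w, w) |` fan u w.
Proof.
move=> uw u1; apply/seteqP; split=> -[[x m] y].
- move=> [T [yE x1 xlt]]; move: T.
  rewrite {}yE triangleE => /andP[xw /eqP ->].
  have [l [e1 e2 xu xm]] := consecutive_progression uw xw.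
  have [l0|l0] := ltP l 0.
    by right; split; [rewrite triangleE xw eqxx|split=> //; rewrite xu].
  left; suff -> : x = u by [].
  have {}l0 : l = 0 by move: xlt; rewrite xm; lia.
  rewrite (surjective_pairing x) (surjective_pairing u); congr pair;
    move: e1 e2; rewrite l0 !mul0r; lia.
- case=> [[-> -> ->]|[T [yw x1 xu]]]; last subst y.
    split; first by rewrite triangleE uw eqxx.
    by split=> //; case/andP: (mediant_inside uw).
  split=> //; split=> //; move: T xu; rewrite triangleE => /andP[xw _].
  by have [l [_ _ -> ->]] := consecutive_progression uw xw; lia.
Qed.

(** Going down to the right edge of a triangle adds this triangle to the fan and
    a factor q to the weight; going down to the left edge starts again from an
    empty fan and the weight 1. *)
Lemma card_fan u w e : edge_weight u w e -> ge_one u ->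
  finite_set (fan u w) /\ #|` fset_set (fan u w)| = e.
Proof.
elim=> [||{}u {}w {}e uw IH|{}u {}w {}e uw IH] u1; first by [].
- have -> : fan (1, 1)%N (1, 0)%N = set0; last by rewrite fset_set0 cardfs0.
  rewrite -subset0 => -[[x m] y] [_ [_]]; rewrite /ge_one /vlt /=; lia.
- by rewrite fan_mediantl ?(edge_weight_consecutive uw)// fset_set0 cardfs0.
- have {}u1 := ge_one_left uw u1; case: (IH u1) => finF cardF.
  rewrite fan_mediantr ?(edge_weight_consecutive uw)//; split.
    by rewrite finite_setU; split.
  rewrite fset_setU1// cardfsU1 cardF in_fset_set// (_ : _ \in _ = false)//.
  by apply/negbTE/negP => /set_mem[_ []]; rewrite vlt_irr.
Qed.

(** * Sums over paths *)

Definition area (v : vertex) (p : seq vertex) : nat :=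
  #|` fset_set (right_exits v p)|.

Lemma oriented_edge_mediant a b y : consecutive a b ->
  oriented_edge (mediant a b) y -> y = a \/ y = b.
Proof.
move=> ab /oriented_edgeP[a' [b' [ab' /(parents_unique ab ab')[-> ->]]]].
by [].
Qed.

Lemma paths_mediant a b w : consecutive a b -> mediant a b <> w ->
  paths (mediant a b) w =
  (cons a @` paths a w) `|` (cons b @` paths b w).
Proof.
move=> ab mw; apply/seteqP; split=> [[|y p]|p].
- by case.
- move=> [/= /andP[/asboolP my yp] lst].
  by case: (oriented_edge_mediant ab my) => yE; subst y; [left|right];
    exists p.
- case=> -[p' [p'p lst] <-]; split=> //=; rewrite p'p andbT; apply/asboolP.
    exact: mediant_edgel.
  exact: mediant_edger.
Qed.

Lemma no_oriented_edge_left y : ~ oriented_edge (0, 1)%N y.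
Proof.
move=> /oriented_edgeP[[a1 a2] [[b1 b2]]].
by rewrite /consecutive /mediant /= => -[ab [e1 e2] _]; move: ab; nia.
Qed.

Lemma no_oriented_edge_oo y : ~ oriented_edge (1, 0)%N y.
Proof.
move=> /oriented_edgeP[[a1 a2] [[b1 b2]]].
by rewrite /consecutive /mediant /= => -[ab [e1 e2] _]; move: ab; nia.
Qed.

Lemma oriented_edge_one y : oriented_edge (1, 1)%N y ->
  y = (0, 1)%N \/ y = (1, 0)%N.
Proof. exact: (@oriented_edge_mediant (0, 1)%N (1, 0)%N). Qed.

Lemma paths_oo w : paths (1, 0)%N w = [set p | p = [::] /\ w = (1, 0)%N].
Proof.
apply/seteqP; split=> [[|y p]|p [-> ->]] //.
  by move=> [_ /= <-].
by move=> [/= /andP[/asboolP /no_oriented_edge_oo]].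
Qed.

Lemma paths_one_one : paths (1, 1)%N (1, 1)%N = [set [::]].
Proof.
apply/seteqP; split=> [[|y p]|p ->] //.
move=> [/= /andP[/asboolP /oriented_edge_one [->|->]] yp lst].
  case: p yp lst => [|z p] //= /andP[/asboolP +].
  by move=> /no_oriented_edge_left.
case: p yp lst => [|z p] //= /andP[/asboolP +].
by move=> /no_oriented_edge_oo.
Qed.

Lemma paths_one_oo : paths (1, 1)%N (1, 0)%N = [set [:: (1, 0)%N]].
Proof.
apply/seteqP; split=> [[|y p]|p ->] //.
- by case.
- move=> [/= /andP[/asboolP /oriented_edge_one [->|->]] yp lst].
    case: p yp lst => [|z p] //= /andP[/asboolP +].
    by move=> /no_oriented_edge_left.
  case: p yp lst => [|z p] //= /andP[/asboolP +].
  by move=> /no_oriented_edge_oo.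
split=> //=; rewrite andbT; apply/asboolP.
exact: (@mediant_edger (0, 1)%N (1, 0)%N).
Qed.

Lemma right_exits_one p : right_exits (1, 1)%N p = set0.
Proof.
rewrite -subset0 => -[[u m] w] [_ [+ + _]].
by rewrite /ge_one /inside /vlt /=; lia.
Qed.

Lemma finite_right_exits_mediantr u w e p : edge_weight u w e -> ge_one u ->
  finite_set (right_exits w p) ->
  finite_set (right_exits (mediant u w) (w :: p)) /\
  area (mediant u w) (w :: p) = (e.+1 + area w p)%N.
Proof.
move=> uw u1 finp; have uwc := edge_weight_consecutive uw.
have m1 : ge_one (mediant u w).
  by move: u1 uwc; rewrite /ge_one /consecutive /=; nia.
have [finF cardF] := card_fan (edge_weight_right uw) m1.
rewrite /area right_exits_right//; split; first by rewrite finite_setU.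
rewrite fset_setU// cardfsU cardF -fset_setI// fan_right_exits_disjoint.
by rewrite fset_set0 cardfs0 subn0.
Qed.

(** Splitting off the first step of a path gives the recursion that defines
    the numerator and the denominator. *)
Theorem qdeformation_path_sum v ND w :
  qdeformation v ND -> ge_one v -> w \in [:: (1, 0)%N; (1, 1)%N] ->
  [/\ finite_set (paths v w),
      forall p, paths v w p -> finite_set (right_exits v p) &
      (if w == (1, 0)%N then ND.1 else ND.2) =
      \sum_(p \in paths v w) ('X^(area v p) : {poly int})].
Proof.
move=> vND + wE; elim: vND => [||| a b e N D N' D' ab aND IHa bND IHb] v1.
- by [].
- have area0 : area (1, 0)%N [::] = 0%N.
    by rewrite /area right_exits_nil fset_set0 cardfs0.
  move: wE; rewrite !inE => /orP[] /eqP -> /=; rewrite paths_oo.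
    have -> : [set p : seq vertex | p = [::] /\ (1, 0)%N = (1, 0)%N :> vertex]
        = [set [::]] by apply/seteqP; split=> p //= [].
    split; [exact: finite_set1| |by rewrite fsbig_set1 area0].
    by move=> p ->; rewrite right_exits_nil.
  have -> : [set p : seq vertex | p = [::] /\ (1, 1)%N = (1, 0)%N :> vertex]
        = set0 by apply/seteqP; split=> p //= [].
  by split=> //; rewrite fsbig_set0.
- have area0 p : area (1, 1)%N p = 0%N.
    by rewrite /area right_exits_one fset_set0 cardfs0.
  move: wE; rewrite !inE => /orP[] /eqP -> /=;
    rewrite ?paths_one_oo ?paths_one_one; split;
    rewrite ?fsbig_set1 ?area0//; try exact: finite_set1.
    by move=> p _; rewrite right_exits_one.
  by move=> p _; rewrite right_exits_one.
- have abc := edge_weight_consecutive ab.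
  have a1 := ge_one_left ab v1.
  have b1 : ge_one b.
    by move: a1 abc; rewrite /ge_one /consecutive; nia.
  have [fina exa suma] := IHa a1; have [finb exb sumb] := IHb b1.
  have mw : mediant a b <> w.
    move=> mE; move: wE; rewrite -mE /mediant !inE !xpair_eqE.
    by move: a1 b1 abc; rewrite /ge_one /consecutive; nia.
  rewrite paths_mediant//; split.
  + by rewrite finite_setU; split; apply: finite_image.
  + move=> p [] [p' pp' <-]; first by rewrite right_exits_left//; apply: exa.
    by have [] := finite_right_exits_mediantr ab a1 (exb _ pp').
  + rewrite fsbigU0; [|exact: finite_image|exact: finite_image|]; last first.
      move=> p [[p1 _ <-]] [p2 _ [ba _]]; move: abc.
      by rewrite ba /consecutive; lia.
    rewrite !fsbig_image; try by move=> ? ? _ _ [].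
    have -> : (if w == (1, 0)%N then (N + 'X^(e.+1) * N', D + 'X^(e.+1) * D').1
       else (N + 'X^(e.+1) * N', D + 'X^(e.+1) * D').2) =
       (if w == (1, 0)%N then N else D) +
       'X^(e.+1) * (if w == (1, 0)%N then N' else D') by case: ifP.
    rewrite suma sumb mulr_fsumr; congr (_ + _); apply: eq_fsbigr => p.
      by rewrite inE => pp; rewrite /area right_exits_left.
    rewrite inE => pp.
    have [_ ->] := finite_right_exits_mediantr ab a1 (exb _ pp).
    by rewrite exprD.
Qed.

(** * Where paths leave the domain under an arc *)

Definition oriented_path (v : vertex) (p : seq vertex) : bool :=
  path (fun x y => `[< oriented_edge x y >]) v p.

(** A path which ends at or after 1/1 never visits a vertex smaller than 1,
    because the only such vertex reachable from 1/1 is the dead end 0/1. *)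
Lemma oriented_path_ge_one v p : oriented_path v p -> ge_one (last v p) ->
  ge_one v -> {in v :: p, forall x, ge_one x}.
Proof.
elim: p v => [|y p IH] v; first by move=> _ _ v1 x; rewrite inE => /eqP ->.
move=> /= /andP[/asboolP vy yp] lst v1 x; rewrite inE => /predU1P[-> //|].
apply: IH => //.
case/oriented_edgeP: vy => a [b [ab vE yE]].
have [//|y1] := boolP (ge_one y).
have yE' : y = (0, 1)%N.
  case: yE => yE; subst y.
    move: v1 y1 ab; rewrite vE /ge_one /consecutive /mediant /=.
    rewrite (surjective_pairing a) /= -ltnNge => v1 y1 /eqP ab.
    have ab2 : (b.2 * (a.1 + 1) + a.2 <= b.1 * a.2)%N by nia.
    congr pair; nia.
  by move: ab v1 y1; rewrite vE /ge_one /consecutive /mediant /=; nia.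
move: lst yp; rewrite yE'; case: p => //= z p _ /andP[/asboolP].
by move=> /no_oriented_edge_left.
Qed.

Lemma last_outside u w x : ge_one u -> x \in [:: (1, 0)%N; (1, 1)%N] ->
  ~~ inside u w x.
Proof.
rewrite !inE /ge_one /inside /vlt => u1 /orP[] /eqP -> /=; last by lia.
by lia.
Qed.

Lemma exit_vertex_end u w v p : consecutive u w -> oriented_path v p ->
  inside u w v -> ~~ inside u w (last v p) ->
  exit_vertex u w v p = u \/ exit_vertex u w v p = w.
Proof.
move=> uw; elim: p v => [|y p IH] v /=; first by move=> _ ->.
move=> /andP[/asboolP vy yp] vin lst; rewrite vin.
have [yin|yin] := boolP (inside u w y); first exact: IH.
by rewrite exit_outside//; apply: (oriented_edge_exit uw vy).
Qed.

Lemma exit_vertex_rcons u w v p x : ~~ inside u w (last v p) ->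
  exit_vertex u w v (rcons p x) = exit_vertex u w v p.
Proof.
elim: p v => [|y p IH] v /=; first by move=> /negbTE ->.
by move=> lst; case: ifP => // _; apply: IH.
Qed.

(** A path that leaves on the left stays to the left of [w] until it leaves,
    and does not come back. *)
Lemma left_exit_edges u w v p : consecutive u w -> oriented_path v p ->
  (inside u w v -> exit_vertex u w v p = u) ->
  {in zip (v :: p) p, forall e, vlt e.1 w && vlt e.2 w ||
    ~~ inside u w e.1 && ~~ inside u w e.2}.
Proof.
move=> uw; elim: p v => [|y p IH] v //=.
move=> /andP[/asboolP vy yp] ex e; rewrite inE => /predU1P[->|] /=; last first.
  apply: IH => // yin; have vin := oriented_edge_inside uw vy yin.
  by have := ex vin; rewrite vin.
have [vin|vin] := boolP (inside u w v); last first.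
  by rewrite (contra (oriented_edge_inside uw vy) vin) orbT.
have {ex} := ex vin; rewrite vin; case/andP: vin => _ ->.
have [/andP[_ ->] //|yin] := boolP (inside u w y).
by rewrite exit_outside// => ->; rewrite consecutive_vlt.
Qed.

Lemma left_path_exists v ND : qdeformation v ND -> ge_one v -> v <> (1, 0)%N ->
  exists p, left_going_paths v (1, 1)%N p.
Proof.
elim=> [||| a b e N D N' D' ab aND IHa bND _] // v1.
  by move=> _; exists [::].
have abc := edge_weight_consecutive ab.
have a1 := ge_one_left ab v1.
have [|p [pp lst]] := IHa a1.
  by move=> aE; move: abc; rewrite aE /consecutive /=; lia.
move=> _; exists (a :: p); split=> //=; rewrite pp andbT; apply/asboolP; split.
  exact: mediant_edgel.
by have /andP[] := mediant_inside abc.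
Qed.

Lemma left_path_to_1P v ND : qdeformation v ND -> ge_one v -> v <> (1, 0)%N ->
  left_going_paths v (1, 1)%N (left_path_to_1 v).
Proof.
move=> vND v1 voo.
exact: (xgetPex [::] (left_path_exists vND v1 voo)).
Qed.

Lemma left_going_oriented v w p : left_going_paths v w p -> oriented_path v p.
Proof.
move=> [pp _]; apply: sub_path pp => x y /asboolP[xy _]; exact/asboolP.
Qed.

Lemma left_going_exit u w v p : consecutive u w ->
  path (fun x y => `[< left_edge x y >]) v p ->
  inside u w v -> ~~ inside u w (last v p) -> exit_vertex u w v p = u.
Proof.
move=> uw; elim: p v => [|y p IH] v /=; first by move=> _ ->.
move=> /andP[/asboolP[vy yv] yp] vin lst; rewrite vin.
have [yin|yin] := boolP (inside u w y); first exact: IH.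
rewrite exit_outside//; case: (oriented_edge_exit uw vy vin yin) => // yw.
by move: vin yv; rewrite yw /inside => /andP[_]; rewrite /vlt; lia.
Qed.

(** The part of the left-path that delimits the coarea of [p]. *)
Definition reference_path (v : vertex) (p : seq vertex) : seq vertex :=
  if last v p == (1, 1)%N then left_path_to_1 v else left_path v.

Lemma reference_pathP v ND p : qdeformation v ND -> ge_one v ->
  v <> (1, 0)%N -> last v p \in [:: (1, 0)%N; (1, 1)%N] ->
  [/\ oriented_path v (reference_path v p),
      last v (reference_path v p) = last v p &
      forall u w, consecutive u w -> ge_one u -> inside u w v ->
        exit_vertex u w v (reference_path v p) = u].
Proof.
move=> vND v1 voo lst; have lP := left_path_to_1P vND v1 voo.
have lo := left_going_oriented lP; case: lP => lp llast.
have lout u w : ge_one u -> ~~ inside u w (last v (left_path_to_1 v)).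
  by move=> u1; rewrite llast last_outside// !inE eqxx orbT.
have lexit u w : consecutive u w -> ge_one u -> inside u w v ->
    exit_vertex u w v (left_path_to_1 v) = u.
  by move=> uw u1 vin; apply: left_going_exit => //; apply: lout.
rewrite /reference_path; case: eqP => [->|pn1]; first by split.
move: lst; rewrite !inE => /orP[/eqP -> | /eqP //].
rewrite /left_path; split; last 1 first.
- by move=> u w uw u1 vin; rewrite exit_vertex_rcons ?lexit ?lout.
- rewrite /oriented_path rcons_path; apply/andP; split; first exact: lo.
  rewrite llast; apply/asboolP.
  exact: (@mediant_edger (0, 1)%N (1, 0)%N).
- by rewrite last_rcons.
Qed.

(** * Half-circles and triangles in the drawing *)

Section Geometry.
Variable R : realType.
Local Notation abscissa := (abscissa R).

(** The power of [z] with respect to the circle of diameter [u, w]. *)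
Definition power (u w : vertex) (z : R * R) : R :=
  (z.1 - abscissa u) * (z.1 - abscissa w) + z.2 ^+ 2.

Lemma half_discE u w (z : R * R) :
  half_disc u w z <-> 0 < z.2 /\ power u w z < 0.
Proof. by rewrite /half_disc /= /power; split=> -[? ?]; split=> //; nra. Qed.

Lemma half_circleE u w (z : R * R) :
  half_circle u w z <-> 0 <= z.2 /\ power u w z = 0.
Proof. by rewrite /half_circle /= /power; split=> -[? ?]; split=> //; nra. Qed.

Lemma powerC u w z : power u w z = power w u z.
Proof. by rewrite /power mulrC. Qed.

Lemma triangle_interiorE u m w (z : R * R) : triangle_interior (u, m, w) z <->
  [/\ 0 < z.2, power u w z < 0, 0 < power u m z & 0 < power m w z].
Proof.
rewrite /triangle_interior; split.
  move=> [/half_discE[z0 pz] nz]; split=> //.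
    have [//|pum|pum] := ltgtP 0 (power u m z); exfalso; apply: nz.
      by left; left; left; apply/half_discE.
    by left; left; right; apply/half_circleE; rewrite ltW.
  have [//|pum|pum] := ltgtP 0 (power m w z); exfalso; apply: nz.
    by left; right; apply/half_discE.
  by right; apply/half_circleE; rewrite ltW.
move=> [z0 pz pum pmw]; split; first exact/half_discE.
by case=> [[[]|]|] => [/half_discE|/half_circleE|/half_discE|/half_circleE];
  lra.
Qed.

Definition nonzero (u : vertex) : bool := (0 < u.1 + u.2)%N.

Lemma abscissa_lt u w : nonzero u -> nonzero w ->
  (abscissa u < abscissa w) = vlt u w.
Proof.
rewrite /nonzero /abscissa /vlt => u0 w0.
rewrite ltr_pdivrMr ?ltr0n// mulrAC ltr_pdivlMr ?ltr0n//.
by rewrite -!natrM ltr_nat; apply/idP/idP; nia.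
Qed.

Lemma abscissa_le u w : nonzero u -> nonzero w ->
  (abscissa u <= abscissa w) = ~~ vlt w u.
Proof. by move=> u0 w0; rewrite leNgt abscissa_lt. Qed.

Lemma vlt_asym u w : vlt u w -> ~~ vlt w u.
Proof. by rewrite /vlt; lia. Qed.

Lemma consecutive_nonzero u w : consecutive u w -> nonzero u /\ nonzero w.
Proof. by rewrite /consecutive /nonzero => uw; split; nia. Qed.

Lemma oriented_edge_nonzero x y : oriented_edge x y -> nonzero x /\ nonzero y.
Proof.
by move=> /oriented_edge_consecutive /orP[] /consecutive_nonzero[].
Qed.

Lemma abscissa_itv u : 0 <= abscissa u <= 1.
Proof.
rewrite /abscissa divr_ge0//=; have [->|u0] := posnP (u.1 + u.2)%N.
  by rewrite invr0 mulr0.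
by rewrite ler_pdivrMr ?ltr0n// mul1r ler_nat leq_addr.
Qed.

Lemma abscissa_ge_one u : nonzero u -> ge_one u -> 1 / 2 <= abscissa u.
Proof.
rewrite /nonzero /ge_one /abscissa => u0 u1.
rewrite ler_pdivlMr ?ltr0n// mulrAC ler_pdivrMr// mul1r -natrM ler_nat; lia.
Qed.

(** Nested diameters have nested half-discs: the difference of the two powers is
    an affine function of the abscissa, which has the right sign at [x] and at
    [y]. *)
Lemma power_nested u w x y z : abscissa u <= abscissa x <= abscissa w ->
  abscissa u <= abscissa y <= abscissa w ->
  0 < power u w z -> 0 < power x y z.
Proof.
rewrite /power.
move: (abscissa u) (abscissa w) (abscissa x) (abscissa y) z.1 z.2 => a b c d s t.
move=> /andP[ac cb] /andP[ad db] h; rewrite ltNge; apply/negP => h'.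
have t0 : 0 <= t ^+ 2 by exact: sqr_ge0.
wlog cd : c d ac cb ad db h' / c <= d.
  move=> wl; case: (leP c d) => [|/ltW]; first exact: wl.
  by apply: wl => //; rewrite mulrC.
have st : c <= s <= d by apply/andP; split; nra.
have : (s - a) * (s - b) <= (s - c) * (s - d) by case/andP: st; nra.
lra.
Qed.

(** An edge with no end strictly between [u] and [w] either passes over the
    whole arc or stays away from it, according to whether its ends are on different
    sides of this arc. *)
Lemma power_outside u w x y z : consecutive u w -> nonzero x -> nonzero y ->
  ~~ inside u w x -> ~~ inside u w y -> power u w z < 0 ->
  if vlt x w == vlt y w then 0 < power x y z else power x y z < 0.
Proof.
move=> uw x0 y0; have [u0 w0] := consecutive_nonzero uw.
have ltuw : abscissa u < abscissa w by rewrite abscissa_lt// consecutive_vlt.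
rewrite /inside -!abscissa_lt// /power => xin yin h.
have t0 : 0 <= z.2 ^+ 2 by exact: sqr_ge0.
have zin : abscissa u < z.1 < abscissa w by apply/andP; split; nra.
move: xin yin ltuw h zin; move: (abscissa u) (abscissa w) (abscissa x).
move: (abscissa y) z.1 (z.2 ^+ 2) t0 => d s t t0 a b c.
rewrite !negb_and -!leNgt => xin yin ab h /andP[sa sb].
by case: (ltP c b) xin => cb /orP[] ca //=; case: (ltP d b) yin => db /orP[] da;
  rewrite /=; nra.
Qed.

(** An edge with an end strictly between [u] and [w] runs inside one of the two
    lower domains, under the arc from [u] to [m] or under the arc from [m] to
    [w], since it crosses neither arc. *)
Lemma power_inside u m w x y (z : R * R) : triangle (u, m, w) ->
  triangle_interior (u, m, w) z ->
  consecutive x y || consecutive y x -> inside u w x -> 0 < power x y z.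
Proof.
rewrite triangleE => /andP[uw /eqP mE].
move=> /triangle_interiorE[z0 puw pum pmw] xy xin.
have um : consecutive u m by rewrite mE consecutive_mediantl.
have mw : consecutive m w by rewrite mE consecutive_mediantr.
have [u0 w0] := consecutive_nonzero uw; have [_ m0] := consecutive_nonzero um.
have [x0 y0] : nonzero x /\ nonzero y.
  by case/orP: xy => /consecutive_nonzero[].
have [ux xw] := andP xin.
have [uy yw] : ~~ vlt y u /\ ~~ vlt w y.
  have uw' := vlt_asym (consecutive_vlt uw).
  case/or3P: (edge_inside uw xin xy) => [/andP[]|/eqP->|/eqP->];
    rewrite ?vlt_irr//.
  by move=> /vlt_asym -> /vlt_asym ->.
have [xm|xm] := boolP (vlt x m).
  have xum : inside u m x by rewrite /inside ux.
  apply: (@power_nested u m) => //;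
    rewrite !abscissa_le ?(vlt_asym ux) ?(vlt_asym xm)//.
  rewrite uy /=; have um' := vlt_asym (consecutive_vlt um).
  by case/or3P: (edge_inside um xum xy) => [/andP[_ /vlt_asym]|/eqP->|/eqP->];
    rewrite ?vlt_irr.
have [mx|mx] := boolP (vlt m x).
  have xmw : inside m w x by rewrite /inside mx.
  apply: (@power_nested m w) => //;
    rewrite !abscissa_le ?(vlt_asym xw) ?(vlt_asym mx)//.
  rewrite yw andbT; have mw' := vlt_asym (consecutive_vlt mw).
  by case/or3P: (edge_inside mw xmw xy) => [/andP[/vlt_asym]|/eqP->|/eqP->];
    rewrite ?vlt_irr.
have [ym|ym] := boolP (vlt y m).
  apply: (@power_nested u m) => //;
    rewrite !abscissa_le ?mx ?uy ?(vlt_asym ux)//=.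
  by rewrite vlt_asym.
by apply: (@power_nested m w) => //;
    rewrite !abscissa_le ?xm ?ym ?yw ?(vlt_asym xw).
Qed.

End Geometry.

(** * A winding number for paths of half-circles *)

Section Winding.
Variable R : realType.
Local Notation abscissa := (abscissa R).

(** The clockwise winding number around [z] of the half-circle followed from [x]
    to [y] and closed by its diameter. *)
Definition disc_sign (x y : vertex) (z : R * R) : int :=
  if (0 < z.2) && (power x y z < 0) then
    if abscissa x < abscissa y then 1 else -1
  else 0.

Fixpoint winding (v : vertex) (p : seq vertex) (z : R * R) : int :=
  if p is y :: p' then disc_sign v y z + winding y p' z else 0.

Definition right_of (z : R * R) (x : vertex) : int :=
  if z.1 < abscissa x then 1 else 0.

Lemma continuous_power x y : continuous (@power R x y).
Proof.
move=> z; rewrite /power; apply: cvgD; apply: cvgM.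
- by apply: cvgB; [exact: cvg_fst|exact: cvg_cst].
- by apply: cvgB; [exact: cvg_fst|exact: cvg_cst].
- exact: cvg_snd.
- exact: cvg_snd.
Qed.

(** At a point of the axis the sign of the disc depends only on the side of the
    axis and on the positions of the two ends, so that it will telescope along
    a path. *)
Lemma disc_sign_near x y (z : R * R) : ~ half_circle x y z ->
  \forall t \near z, ~ half_circle x y t /\
    disc_sign x y t = if z.2 == 0 then
      if 0 < t.2 then right_of z y - right_of z x else 0
    else disc_sign x y z.
Proof.
move=> nz.
have snd_cvg : t.2 @[t --> z] --> z.2 by exact: cvg_snd.
have pow_cvg := @continuous_power x y z.
have [z0|z0|z0] := ltgtP z.2 0.
- near=> t; have t0 : t.2 < 0 by near: t; exact: cvgr_lt snd_cvg _ z0.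
  split; first by move=> /half_circleE[]; rewrite leNgt t0.
  by rewrite /disc_sign (lt_gtF t0) (lt_gtF z0).
- have [p0|p0|p0] := ltgtP (power x y z) 0.
  + near=> t; have t0 : 0 < t.2 by near: t; exact: cvgr_gt snd_cvg _ z0.
    have pt : power x y t < 0 by near: t; exact: cvgr_lt pow_cvg _ p0.
    split; first by move=> /half_circleE[_ /eqP]; rewrite lt_eqF.
    by rewrite /disc_sign t0 z0 pt p0.
  + near=> t; have t0 : 0 < t.2 by near: t; exact: cvgr_gt snd_cvg _ z0.
    have pt : 0 < power x y t by near: t; exact: cvgr_gt pow_cvg _ p0.
    split; first by move=> /half_circleE[_ /eqP]; rewrite gt_eqF.
    by rewrite /disc_sign t0 z0 (lt_gtF pt) (lt_gtF p0).
  + by exfalso; apply: nz; apply/half_circleE; rewrite ltW.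
- have [p0|p0|p0] := ltgtP (power x y z) 0.
  + near=> t; have pt : power x y t < 0 by near: t; exact: cvgr_lt pow_cvg _ p0.
    split; first by move=> /half_circleE[_ /eqP]; rewrite lt_eqF.
    rewrite /disc_sign pt andbT; case: ifP => // _.
    have p1 : (z.1 - abscissa x) * (z.1 - abscissa y) < 0.
      by have := p0; rewrite /power z0 expr0n addr0.
    rewrite /right_of.
    by case: ltP => xy; case: ltP => zy; case: ltP => zx //; exfalso; nra.
  + near=> t; have pt : 0 < power x y t by near: t; exact: cvgr_gt pow_cvg _ p0.
    split; first by move=> /half_circleE[_ /eqP]; rewrite gt_eqF.
    rewrite /disc_sign (lt_gtF pt) andbF; case: ifP => // _.
    have p1 : 0 < (z.1 - abscissa x) * (z.1 - abscissa y).
      by have := p0; rewrite /power z0 expr0n addr0.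
    rewrite /right_of.
    by case: (ltP z.1) => zy; case: (ltP z.1) => zx //; exfalso; nra.
  + by exfalso; apply: nz; apply/half_circleE; rewrite z0 lexx.
Unshelve. all: by end_near. Qed.

Lemma path_curve_cons v y p : path_curve v (y :: p) =
  half_circle v y `|` path_curve y p :> set (R * R).
Proof.
apply/seteqP; split=> z.
  move=> [e /=]; rewrite inE => /predU1P[->|ep] ez; first by left.
  by right; exists e.
case=> [ez|[e ep ez]]; first by exists (v, y) => //=; rewrite inE eqxx.
by exists e => //=; rewrite inE [X in _ || X]ep orbT.
Qed.

Lemma winding_near v p (z : R * R) : ~ path_curve v p z ->
  \forall t \near z, ~ path_curve v p t /\
    winding v p t = if z.2 == 0 then
      if 0 < t.2 then right_of z (last v p) - right_of z v else 0
    else winding v p z.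
Proof.
elim: p v => [|y p IH] v.
  move=> _; near=> t; split; first by case=> e.
  by rewrite /= subrr; case: ifP => // _; case: ifP.
rewrite path_curve_cons => /not_orP[nvy ny].
near=> t.
have [nt dt] : ~ half_circle v y t /\ disc_sign v y t = if z.2 == 0 then
      if 0 < t.2 then right_of z y - right_of z v else 0
    else disc_sign v y z by near: t; exact: disc_sign_near.
have [nt' wt] : ~ path_curve y p t /\ winding y p t = if z.2 == 0 then
      if 0 < t.2 then right_of z (last y p) - right_of z y else 0
    else winding y p z by near: t; exact: IH.
split; first by case.
rewrite /= dt wt; case: ifP => // _; case: ifP => // _.
by rewrite addrC subrKA.
Unshelve. all: by end_near. Qed.

Lemma winding_diff_near v p q (z : R * R) : last v p = last v q ->
  ~ (path_curve v p `|` path_curve v q) z ->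
  \forall t \near z, ~ (path_curve v p `|` path_curve v q) t /\
    winding v p t - winding v q t = winding v p z - winding v q z.
Proof.
move=> pq /not_orP[zp zq].
have := winding_near zp; have := winding_near zq; rewrite pq => nq np.
have [_ wq] := nbhs_singleton nq; have [_ wp] := nbhs_singleton np.
near=> t.
have [tq ->] : ~ path_curve v q t /\
    winding v q t = if z.2 == 0 then
      if 0 < t.2 then right_of z (last v q) - right_of z v else 0
    else winding v q z by near: t.
have [tp ->] : ~ path_curve v p t /\
    winding v p t = if z.2 == 0 then
      if 0 < t.2 then right_of z (last v q) - right_of z v else 0
    else winding v p z by near: t.
split; first by case.
by case: ifP wp wq => [_ -> ->|]; rewrite ?subrr.
Unshelve. all: by end_near. Qed.

Lemma disc_sign_far x y (z : R * R) : ~~ (`|z| <= 1) -> disc_sign x y z = 0.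
Proof.
move=> zfar; rewrite /disc_sign; case: ifP => // /andP[z0 pz].
exfalso; move/negP: zfar; apply; rewrite prod_normE ge_max.
have := abscissa_itv R x; have := abscissa_itv R y.
move: pz z0; rewrite /power; move: (abscissa x) (abscissa y) z.1 z.2.
move=> a b s t pz t0 /andP[b0 b1] /andP[a0 a1].
have s0 : 0 <= s by nra.
have s1 : s <= 1 by nra.
rewrite !ger0_norm ?(ltW t0)// s1 /=; nra.
Qed.

Lemma winding_far v p (z : R * R) : ~~ (`|z| <= 1) -> winding v p z = 0.
Proof.
move=> zfar; elim: p v => //= y p IH v.
by rewrite disc_sign_far// IH addr0.
Qed.

(** The difference of the winding numbers is constant on each component of the
    complement of the two curves, and it vanishes far away. *)
Lemma winding_enclosed v p q (z : R * R) : last v p = last v q ->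
  ~ (path_curve v p `|` path_curve v q) z ->
  winding v p z != winding v q z ->
  enclosed (path_curve v p `|` path_curve v q) z.
Proof.
move=> pq zK wz; set K := _ `|` _ in zK *; split=> //.
pose f (t : R * R) := winding v p t - winding v q t.
pose C := connected_component (~` K) z.
have openf (P : set int) : open (~` K `&` f @^-1` P).
  rewrite openE => t [tK Pt]; have nt := winding_diff_near pq tK.
  rewrite /interior; near=> s.
  have [sK fs] : ~ K s /\ f s = f t by near: s.
  by split=> //; rewrite /preimage /= fs.
have Cf : C `&` (~` K `&` f @^-1` [set f z]) = C.
  apply: (@component_connected _ (~` K) z).
  - by exists z; split; [exact: connected_component_refl|split].
  - by exists (~` K `&` f @^-1` [set f z]) => //; exact: openf.
  - exists (~` (~` K `&` f @^-1` (~` [set f z]))).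
      exact/open_closedC/openf.
    apply/seteqP; split=> t [Ct].
      by move=> [tK ft]; split=> // -[_]; apply.
    move=> nt; have tK := connected_component_sub Ct.
    by split=> //; split=> //; apply: contrapT => nft; apply: nt.
exists 1; split=> // M M1 t; rewrite -/C -Cf => -[_ [_ /= ft]].
apply: le_trans (ltW M1); apply: contraT => tfar.
move: ft; rewrite /f !(winding_far _ _ tfar) subrr => /esym/eqP.
by rewrite subr_eq0 (negbTE wz).
Unshelve. all: by end_near. Qed.

End Winding.

(** * Enclosed triangles *)

Section Enclosed.
Variable R : realType.
Local Notation abscissa := (abscissa R).

Lemma oriented_path_edges v p : oriented_path v p ->
  {in zip (v :: p) p, forall e, oriented_edge e.1 e.2}.
Proof.
elim: p v => [|y p IH] v //= /andP[/asboolP vy yp] e.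
by rewrite inE => /predU1P[->//|]; apply: IH.
Qed.

Lemma zip_path_mem (v : vertex) (p : seq vertex) e : e \in zip (v :: p) p ->
  e.1 \in v :: p /\ e.2 \in v :: p.
Proof.
elim: p v => [|y p IH] v //=; rewrite inE => /predU1P[->|/IH[e1 e2]] /=.
  by rewrite !inE !eqxx !orbT.
by rewrite !inE in e1 e2 *; rewrite e1 e2 !orbT.
Qed.

Lemma interior_off_edge u m w x y (z : R * R) : triangle (u, m, w) ->
  triangle_interior (u, m, w) z -> oriented_edge x y -> power x y z != 0.
Proof.
move=> T zT xy; have [x0 y0] := oriented_edge_nonzero xy.
have xyc := oriented_edge_consecutive xy.
have uw : consecutive u w by move: T; rewrite triangleE => /andP[].
have [xin|xin] := boolP (inside u w x).
  by rewrite gt_eqF// (power_inside T zT xyc xin).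
have [yin|yin] := boolP (inside u w y).
  by rewrite powerC gt_eqF// (power_inside T zT _ yin)// orbC.
have [_ pz _ _] := (triangle_interiorE u m w z).1 zT.
have := power_outside uw x0 y0 xin yin pz.
by case: eqP => _ pxy; [rewrite gt_eqF|rewrite lt_eqF].
Qed.

Lemma interior_off_path u m w v p (z : R * R) : triangle (u, m, w) ->
  triangle_interior (u, m, w) z -> oriented_path v p -> ~ path_curve v p z.
Proof.
move=> T zT vp [e ep /half_circleE[_ ez]].
by have := interior_off_edge T zT (oriented_path_edges vp ep); rewrite ez eqxx.
Qed.

Lemma disc_sign_interior u m w x y (z : R * R) : triangle (u, m, w) ->
  triangle_interior (u, m, w) z -> oriented_edge x y ->
  disc_sign x y z = if inside u w x then 0 else (vlt x w)%:Z - (vlt y w)%:Z.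
Proof.
move=> T zT xy; have [x0 y0] := oriented_edge_nonzero xy.
have xyc := oriented_edge_consecutive xy.
have uw : consecutive u w by move: T; rewrite triangleE => /andP[].
have [z0 pz _ _] := (triangle_interiorE u m w z).1 zT.
rewrite /disc_sign z0 /=; have [xin|xin] := boolP (inside u w x).
  by rewrite lt_gtF// (power_inside T zT xyc xin).
have yin : ~~ inside u w y by apply: contra xin; apply: oriented_edge_inside.
have := power_outside uw x0 y0 xin yin pz.
have [-> pxy|xwy pxy] := eqVneq (vlt x w) (vlt y w).
  by rewrite lt_gtF ?subrr.
have [u0 w0] := consecutive_nonzero uw.
have ltuw : abscissa u < abscissa w by rewrite abscissa_lt// consecutive_vlt.
move: xwy xin yin; rewrite pxy /inside -!(@abscissa_lt R)//.
case: (ltP _ (abscissa w)) => xw; case: (ltP _ (abscissa w)) => yw // _;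
  rewrite ?andbT ?andbF -?leNgt => xin yin.
- by rewrite (_ : _ < _)//; lra.
- by rewrite ltNge (_ : _ <= _)//; lra.
Qed.

(** The edges taken before leaving the domain under the arc contribute nothing,
    and the contributions of the later ones telescope. *)
Lemma winding_interior u m w v p (z : R * R) : triangle (u, m, w) ->
  triangle_interior (u, m, w) z -> oriented_path v p ->
  ~~ inside u w (last v p) ->
  winding v p z = (vlt (exit_vertex u w v p) w)%:Z - (vlt (last v p) w)%:Z.
Proof.
move=> T zT; elim: p v => [|y p IH] v /=; first by rewrite subrr.
move=> /andP[/asboolP vy yp] lst.
have uw : consecutive u w by move: T; rewrite triangleE => /andP[].
rewrite (disc_sign_interior T zT vy) (IH _ yp lst).
case: ifPn => vin; first by rewrite add0r.
rewrite exit_outside; last first.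
  by apply: contra vin; apply: oriented_edge_inside.
by rewrite addrA subrK.
Qed.

(** The two paths leave the domain under the arc through different ends, so
    their winding numbers around a point of the triangle differ. *)
Lemma right_exits_enclosed v ND p t : qdeformation v ND -> ge_one v ->
  v <> (1, 0)%N -> oriented_path v p ->
  last v p \in [:: (1, 0)%N; (1, 1)%N] -> right_exits v p t ->
  triangle_interior t `<=`
    enclosed (path_curve v p `|` path_curve v (reference_path v p)
      : set (R * R)).
Proof.
case: t => [[u m] w] vND v1 voo vp lst [T [u1 vin ex]] z zT.
have uw : consecutive u w by move: T; rewrite triangleE => /andP[].
have [vq qlst qex] := reference_pathP vND v1 voo lst.
have lout := last_outside w u1 lst.
apply: winding_enclosed; first by rewrite qlst.
  by case; apply: interior_off_path T zT _.
rewrite !(winding_interior T zT)// ?qlst// ex qex// vlt_irr.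
by rewrite (consecutive_vlt uw); case: (vlt _ _).
Qed.

Lemma ray_not_enclosed (K : set (R * R)) (z : R * R) :
  (forall t, t <= z.2 -> ~ K (z.1, t)) -> ~ enclosed K z.
Proof.
move=> ray [zK [M [_ bM]]].
pose ray_set := (fun t => (z.1, t)) @` [set` `]-oo, z.2]].
have rayC : ray_set `<=` connected_component (~` K) z.
  apply: connected_component_max.
  - by exists z.2; [rewrite /= in_itv /= lexx|case: (z)].
  - by move=> _ [t + <-]; rewrite /= in_itv /=; apply: ray.
  - apply: connected_continuous_connected.
      exact/connected_intervalP/interval_is_interval.
    apply: continuous_subspaceT => t.
    by apply: (@cvg_pair _ _ _ _ (nbhs z.1) (nbhs t)); [exact: cvg_cst|exact: cvg_id].
pose b := `|M| + `|z.2| + 2.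
have b0 : 0 <= b by rewrite /b !addr_ge0.
have zb : - b <= z.2.
  have nz := lerNnormlW (lexx `|z.2|); have nM := normr_ge0 M.
  rewrite /b; lra.
have Mb : M < `|M| + 1 by rewrite (le_lt_trans (ler_norm M)) ?ltrDl.
have /(bM _ Mb) : connected_component (~` K) z (z.1, - b).
  by apply: rayC; exists (- b) => //=; rewrite in_itv.
rewrite /= prod_normE ge_max /= normrN (ger0_norm b0) => /andP[_].
by have nz := normr_ge0 z.2; rewrite /b => ?; lra.
Qed.

(** Near [w] the triangle has points to the right of any finite set of vertices
    smaller than [w]. *)
Lemma triangle_interior_right u m w (s : seq vertex) : triangle (u, m, w) ->
  (forall x, x \in s -> nonzero x) ->
  exists2 z : R * R, triangle_interior (u, m, w) z &
    forall x, x \in s -> vlt x w -> abscissa x < z.1.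
Proof.
rewrite triangleE => /andP[uw /eqP mE] s0.
have um : consecutive u m by rewrite mE consecutive_mediantl.
have mw : consecutive m w by rewrite mE consecutive_mediantr.
have [u0 w0] := consecutive_nonzero uw; have [_ m0] := consecutive_nonzero um.
have [c [mc cw cs]] : exists c, [/\ abscissa m < c, c < abscissa w &
    forall x, x \in s -> vlt x w -> abscissa x < c].
  elim: s s0 => [|x s IH] s0.
    exists ((abscissa m + abscissa w) / 2); split=> //.
      by have := consecutive_vlt mw; rewrite -(@abscissa_lt R)//; lra.
    by have := consecutive_vlt mw; rewrite -(@abscissa_lt R)//; lra.
  have [|c [mc cw cs]] := IH; first by move=> y ys; apply: s0; rewrite inE ys orbT.
  have [xw|xw] := boolP (vlt x w); last first.
    exists c; split=> // y; rewrite inE => /predU1P[->|]; last exact: cs.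
    by rewrite (negbTE xw).
  have xw' : abscissa x < abscissa w.
    by rewrite abscissa_lt//; apply: s0; rewrite inE eqxx.
  have mx : Num.max c (abscissa x) < abscissa w by rewrite gt_max cw.
  have cx : c <= Num.max c (abscissa x) by rewrite le_max lexx.
  have xx : abscissa x <= Num.max c (abscissa x) by rewrite le_max lexx orbT.
  exists ((Num.max c (abscissa x) + abscissa w) / 2); split; [lra|lra|].
  move=> y; rewrite inE => /predU1P[-> _|ys yw]; first by lra.
  by have := cs y ys yw; lra.
have ltum : abscissa u < abscissa m by rewrite abscissa_lt// consecutive_vlt.
(* The mean of the squared heights of the arcs ending at [w], at abscissa [c]. *)
pose h := (c - (abscissa u + abscissa m) / 2) * (abscissa w - c).
have h0 : 0 < h by rewrite /h; apply: mulr_gt0; lra.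
exists (c, Num.sqrt h) => //; apply/triangle_interiorE.
rewrite /power /= sqr_sqrtr ?(ltW h0)// sqrtr_gt0 /h; split=> //; nra.
Qed.

(** The triangle is the one from 0/1 to 1/0, and 1/2 is the abscissa of 1/1:
    the point found lies to the left of all fractions that are at least 1. *)
Lemma triangle_interior_low u m w : triangle (u, m, w) -> ~~ ge_one u ->
  (w.2 < w.1)%N ->
  exists2 z : R * R, triangle_interior (u, m, w) z & z.1 < 1 / 2.
Proof.
rewrite triangleE /ge_one => /andP[uw /eqP ->] u1 w1.
have [|e1 e2] := inside_ge (x := (1, 1)%N) uw.
  by rewrite /inside /vlt /=; lia.
have -> : u = (0, 1)%N.
  rewrite (surjective_pairing u); rewrite /= in e1 e2; congr pair; lia.
have -> : w = (1, 0)%N.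
  rewrite (surjective_pairing w); rewrite /= in e1 e2; congr pair; lia.
(* At abscissa 1/4 the squared heights of the arcs are 1/16 and 3/16. *)
exists (1 / 4, Num.sqrt (1 / 8)) => /=; last by lra.
apply/triangle_interiorE; rewrite /power /= sqr_sqrtr ?sqrtr_gt0; last by lra.
have -> : abscissa (0, 1)%N = 0 by rewrite /Defs.abscissa mul0r.
have -> : abscissa (1, 0)%N = 1 by rewrite /Defs.abscissa divr1.
have -> : abscissa (mediant (0, 1)%N (1, 0)%N) = 1 / 2 by [].
by split; lra.
Qed.

Lemma path_curve_edge v p (z : R * R) : path_curve v p z ->
  exists2 e, e \in zip (v :: p) p & 0 <= z.2 /\ power e.1 e.2 z = 0.
Proof. by move=> [e ep /half_circleE]; exists e. Qed.

(** Either the triangle is the one from 0/1 to 1/0, and all edges are to the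
    right of one of its points, or each edge stays to the left of a point near [w] or
    has both ends outside the domain under the arc; in all cases nothing is met
    when going down from this point. *)
Lemma not_right_exits_not_enclosed v ND p t : qdeformation v ND -> ge_one v ->
  v <> (1, 0)%N -> oriented_path v p ->
  last v p \in [:: (1, 0)%N; (1, 1)%N] -> triangle t -> ~ right_exits v p t ->
  ~ triangle_interior t `<=`
    enclosed (path_curve v p `|` path_curve v (reference_path v p)
      : set (R * R)).
Proof.
case: t => [[u m] w] vND v1 voo vp lst T nt sub.
have uw : consecutive u w by move: T; rewrite triangleE => /andP[].
have [vq qlst qex] := reference_pathP vND v1 voo lst.
have last1 : ge_one (last v p) by case/predU1P: lst => [->|/predU1P[->|]].
have one_p := oriented_path_ge_one vp last1 v1.
have one_q : {in v :: reference_path v p, forall x, ge_one x}.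
  by apply: oriented_path_ge_one => //; rewrite qlst.
have edge_p := oriented_path_edges vp; have edge_q := oriented_path_edges vq.
pose E := zip (v :: p) p ++
  zip (v :: reference_path v p) (reference_path v p).
have EP e : e \in E -> [/\ oriented_edge e.1 e.2, ge_one e.1 & ge_one e.2].
  rewrite mem_cat => /orP[] eE; have [e1 e2] := zip_path_mem eE.
    by split; [exact: edge_p|exact: one_p|exact: one_p].
  by split; [exact: edge_q|exact: one_q|exact: one_q].
suff [z zT zE] : exists2 z : R * R, triangle_interior (u, m, w) z &
    forall e t, e \in E -> 0 <= t <= z.2 -> power e.1 e.2 (z.1, t) != 0.
  apply: ray_not_enclosed (sub _ zT) => t tz.
  by case=> /path_curve_edge[e eE /= [t0 pe]];
    have := zE e t; rewrite mem_cat eE ?orbT t0 tz pe eqxx => /(_ isT isT).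
have [/andP[u1 w1]|uw1] := boolP (~~ ge_one u && (w.2 < w.1)%N).
  have [z zT z1] := triangle_interior_low T u1 w1.
  exists z => // e t /EP[/oriented_edge_nonzero[x0 y0] x1 y1] _.
  have x2 := abscissa_ge_one R x0 x1; have y2 := abscissa_ge_one R y0 y1.
  have t0 := sqr_ge0 t.
  rewrite /power gt_eqF//= ltr_wpDr// nmulr_rgt0; lra.
have EP' e : e \in E -> vlt e.1 w && vlt e.2 w ||
    ~~ inside u w e.1 && ~~ inside u w e.2.
  move=> eE; have [_ x1 y1] := EP e eE.
  have [u1|u1] := boolP (ge_one u); last first.
    move: uw1; rewrite u1 /= -leqNgt => w1.
    have out x : ge_one x -> ~~ inside u w x.
      move=> xge; rewrite /inside negb_and; apply/orP; right.
      by rewrite /vlt -leqNgt mulnC leq_mul.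
    by rewrite !out ?orbT.
  move: eE; rewrite mem_cat => /orP[].
    apply: left_exit_edges => // vin.
    have lout := last_outside w u1 lst.
    case: (exit_vertex_end uw vp vin lout) => // ex.
    by exfalso; apply: nt.
  by apply: left_exit_edges => //; apply: qex.
have [|z zT zs] := @triangle_interior_right u m w
    (map fst E ++ map snd E) T.
  move=> x; rewrite mem_cat => /orP[] /mapP[e /EP[]];
  by move=> /oriented_edge_nonzero[? ?] _ _ ->.
exists z => // e t eE /andP[t0 tz].
have [/oriented_edge_nonzero[x0 y0] _ _] := EP e eE.
have [z0 pz _ _] := (triangle_interiorE u m w z).1 zT.
have tt : t ^+ 2 <= z.2 ^+ 2 by rewrite ler_pXn2r// nnegrE ltW.
case/orP: (EP' e eE) => /andP[xw yw].
  have xz : abscissa e.1 < z.1.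
    by apply: zs xw; rewrite mem_cat map_f.
  have yz : abscissa e.2 < z.1.
    by apply: zs yw; rewrite mem_cat (map_f snd eE) orbT.
  have tt0 := sqr_ge0 t.
  by rewrite /power gt_eqF//= ltr_wpDr// mulr_gt0// subr_gt0.
have pt : power u w (z.1, t) < 0.
  by move: pz; rewrite /power /=; lra.
have := power_outside uw x0 y0 xw yw pt.
by case: eqP => _ pxy; [rewrite gt_eqF|rewrite lt_eqF].
Qed.

Theorem coareaE v ND p : qdeformation v ND -> ge_one v -> v <> (1, 0)%N ->
  oriented_path v p -> last v p \in [:: (1, 0)%N; (1, 1)%N] ->
  coarea R v p = area v p.
Proof.
move=> vND v1 voo vp lst; rewrite /coarea /area.
congr (#|` fset_set _|); apply/seteqP; split=> t.
  move=> [T sub]; apply: contrapT => nt.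
  exact: (not_right_exits_not_enclosed vND v1 voo vp lst T nt sub).
move=> tr; split; last exact: (right_exits_enclosed vND v1 voo vp lst tr).
by case: t tr => [[u m] w] [].
Qed.

End Enclosed.

Theorem theorem2 (K : realType) (r s : nat) (s_gt0 : (0 < s)%N)
    (rs_coprime : coprime r s) (rs_gt1 : (s < r)%N) (R S : {poly int})
    (RS_def : qdeformation (r, s) (R, S)) :
  R = \sum_(p \in paths (r, s) (1, 0)%N) ('X^(coarea K (r, s) p) : {poly int}) /\
  S = \sum_(p \in paths (r, s) (1, 1)%N) ('X^(coarea K (r, s) p) : {poly int}).
Proof.
have rs1 : ge_one (r, s) by rewrite /ge_one /= ltnW.
have rsoo : (r, s) <> (1, 0)%N by case=> _ s0; rewrite s0 in s_gt0.
have coarE w : w \in [:: (1, 0)%N; (1, 1)%N] ->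
    \sum_(p \in paths (r, s) w) ('X^(coarea K (r, s) p) : {poly int}) =
    \sum_(p \in paths (r, s) w) ('X^(area (r, s) p) : {poly int}).
  move=> wE; apply: eq_fsbigr => p; rewrite inE => -[vp lst].
  by rewrite (coareaE _ RS_def)// lst.
rewrite !coarE ?inE ?eqxx ?orbT//; split.
  by have [] := qdeformation_path_sum (w := (1, 0)%N) RS_def rs1 isT.
by have [] := qdeformation_path_sum (w := (1, 1)%N) RS_def rs1 isT.
Qed.
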